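(* Let $X$ be a metric space (with metric $d$, not assumed to be compact) and $f\colon X\to X$ a continuous map. If $f$ has the positive $\mathcal{T}_0$-inverse shadowing property, then the system $(X,f)$ is not eventually sensitive. (If $f$ is a homeomorphism with $\mathcal{T}_0$-inverse shadowing, then neither $(X,f)$ nor the inverse system $(X,f^{-1})$ is eventually sensitive.)
   Context: $\omega=\{0,1,2,\dots\}$; $B_\varepsilon(a)$ is the open ball of radius $\varepsilon$ about $a$. For $\delta>0$ and a homeomorphism $f\colon X\to X$, a $\delta$-pseudo-orbit is a bi-infinite sequence $(x_k)_{k\in\mathbb{Z}}$ in $X$ with $d(f(x_k),x_{k+1})<\delta$ for all $k\in\mathbb{Z}$; for a continuous $f\colon X\to X$, a positive $\delta$-pseudo-orbit is a sequence $(x_k)_{k\in\omega}$ in $X$ with $d(f(x_k),x_{k+1})<\delta$ for all $k\in\omega$. Let $\Phi_f(\delta)\subseteq X^{\mathbb{Z}}$ (resp. $\Phi_f^+(\delta)\subseteq X^\omega$) be the set of all $\delta$-pseudo-orbits (resp. positive $\delta$-pseudo-orbits). A $\delta$-method (resp. positive $\delta$-method) for $f$ is a map $\varphi\colon X\to\Phi_f(\delta)$ (resp. $\varphi\colon X\to\Phi_f^+(\delta)$), not necessarily continuous, such that $\varphi(x)_0=x$ for every $x\in X$, where $\varphi(x)_k$ denotes the $k$-th term of $\varphi(x)$. $\mathcal{T}_0(f,\delta)$ is the set of all $\delta$-methods (resp. all positive $\delta$-methods, when the positive version is considered). A homeomorphism (resp. continuous map) $f$ has $\mathcal{T}_0$-inverse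 shadowing (resp. positive $\mathcal{T}_0$-inverse shadowing) if for any $\varepsilon>0$ there exists $\delta>0$ such that for any $x\in X$ and any $\delta$-method (resp. positive $\delta$-method) $\varphi\in\mathcal{T}_0(f,\delta)$ there exists $y\in X$ such that $d(\varphi(y)_k,f^k(x))<\varepsilon$ for all $k\in\mathbb{Z}$ (resp. $k\in\omega$). A dynamical system $(X,g)$ is eventually sensitive if there exists $\delta>0$ such that for any $x\in X$ and any $\varepsilon>0$ there exist $n,k\in\omega$ and $y\in B_\varepsilon(g^n(x))$ such that $d(g^{n+k}(x),g^k(y))\geq\delta$. *)

(* Defs.v *)
From mathcomp Require Import all_boot all_order all_algebra.
From mathcomp Require Import classical_sets reals topology.

Set Implicit Arguments.
Unset Strict Implicit.
Unset Printing Implicit Defensive.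

Import Order.TTheory GRing.Theory Num.Theory.
Local Open Scope classical_set_scope.
Local Open Scope ring_scope.

(* A homeomorphism is presented together with its inverse [g]. *)
Definition homeomorphism {X : topologicalType} (f g : X -> X) : Prop :=
  [/\ continuous f, continuous g, cancel f g & cancel g f].

(* The integer iterate f^k, where [g] is the inverse of [f];
   recall that [Negz n] is the integer -(n + 1). *)
Definition iterz {X : Type} (f g : X -> X) (k : int) (x : X) : X :=
  match k with
  | Posz n => iter n f x
  | Negz n => iter n.+1 g x
  end.

Section Shadowing.
Context {R : realType} {X : metricType R}.
Implicit Types (f g : X -> X) (delta : R).

Definition pseudo_orbits f delta : set (int -> X) :=
  [set x | forall k : int, mdist (f (x k)) (x (k + 1)) < delta].

Definition pos_pseudo_orbits f delta : set (nat -> X) :=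
  [set x | forall k : nat, mdist (f (x k)) (x k.+1) < delta].

Definition T0_methods f delta : set (X -> int -> X) :=
  [set phi | forall x, pseudo_orbits f delta (phi x) /\ phi x 0 = x].

Definition pos_T0_methods f delta : set (X -> nat -> X) :=
  [set phi | forall x, pos_pseudo_orbits f delta (phi x) /\ phi x 0%N = x].

Definition T0_inverse_shadowing f g : Prop :=
  forall eps : R, 0 < eps -> exists2 delta : R, 0 < delta &
    forall (x : X) (phi : X -> int -> X), T0_methods f delta phi ->
      exists y : X, forall k : int, mdist (phi y k) (iterz f g k x) < eps.

Definition pos_T0_inverse_shadowing f : Prop :=
  forall eps : R, 0 < eps -> exists2 delta : R, 0 < delta &
    forall (x : X) (phi : X -> nat -> X), pos_T0_methods f delta phi ->
      exists y : X, forall k : nat, mdist (phi y k) (iter k f x) < eps.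

Definition eventually_sensitive f : Prop :=
  exists2 delta : R, 0 < delta &
    forall (x : X) (eps : R), 0 < eps ->
      exists (n k : nat) (y : X), ball (iter n f x) eps y /\
        delta <= mdist (iter (n + k) f x) (iter k f y).

End Shadowing.

(* Main.v *)
Require Import Defs.
From mathcomp Require Import all_boot all_order all_algebra.
From mathcomp Require Import classical_sets reals topology.
From mathcomp Require boolp lra.
Local Open Scope classical_set_scope.

(** Inverse shadowing lets the adversary choose, for every starting point [z],
    one pseudo-orbit issued from [z], with no continuity in [z].  Let [f] be
    eventually sensitive with constant [delta0] and fix a point [x].  Along the
    orbit of any [z] there are a time [n] and a point [y] as close to [f^n z] as
    desired whose orbit is, [k] steps later, at distance at least [delta0] from
    that of [z].  Both the orbit of [z] and the pseudo-orbit that follows [z]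
    until time [n] and then jumps to the orbit of [y] start at [z], and their
    values at time [n + k] are too far apart to be both within [delta0 / 2] of
    [f^(n + k) x].  Choosing for every [z] whichever of the two strays yields a
    method none of whose pseudo-orbits stays [delta0 / 2]-close to the orbit of
    [x] ([stray_pos_pseudo_orbit], [no_pos_T0_inverse_shadowing]).

    The jump must not alter the initial term, so it has to take place at a
    positive time; this is arranged by applying sensitivity to [f z] in place
    of [z].

    For a homeomorphism, a one-sided pseudo-orbit of [f] is continued into the
    past by the exact orbit, which settles the sensitivity of [f].  When the
    inverse [g] is sensitive, the jump is made in the past and its error is
    measured after an application of [f].  Jumping from [g^n z] to [g y]
    rather than from [g^(n-1) z] to [y] makes this error
    [d(f (g y), g^n z) = d(y, g^n z)], so no modulus of continuity of [f] enters
    ([stray_neg_pseudo_orbit]).  The time at which the two orbits are apart is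
    still reached, because it is not [n] itself once [y] is taken within
    [delta0] of [g^n z]. *)

Set Implicit Arguments.
Unset Strict Implicit.
Unset Printing Implicit Defensive.

Import Order.TTheory GRing.Theory Num.Theory.
Import lra.
Local Open Scope ring_scope.

(** * Splicing orbits *)

Definition splice {X : Type} (f : X -> X) (n : nat) (z y : X) (j : nat) : X :=
  if (j < n)%N then iter j f z else iter (j - n) f y.

Lemma splice0 {X : Type} (f : X -> X) (n : nat) (z y : X) :
  splice f n.+1 z y 0 = z.
Proof. by []. Qed.

Lemma splice_after {X : Type} (f : X -> X) (n k : nat) (z y : X) :
  splice f n z y (n + k) = iter k f y.
Proof. by rewrite /splice ltnNge leq_addr /= addKn. Qed.

(** Consecutive terms of a splice are related by [f] except at the jump, which
    lets any relation be checked at the jump alone. *)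
Lemma splice_step {X : Type} (f : X -> X) (n : nat) (z y : X)
    (P : X -> X -> Prop) :
  (forall t, P t (f t)) -> P (iter n f z) y ->
  forall j, P (splice f n.+1 z y j) (splice f n.+1 z y j.+1).
Proof.
move=> Pf Pjump j; rewrite /splice !ltnS.
have [ltjn|ltnj|->] := ltngtP j n.
- exact: Pf.
- by rewrite (subSn ltnj) iterS; exact: Pf.
- by rewrite subnn.
Qed.

(** * Two-sided sequences *)

Definition glue {X : Type} (p q : nat -> X) (k : int) : X :=
  match k with Posz n => p n | Negz n => q n.+1 end.

Section NotSensitive.
Context {R : realType} {X : metricType R}.
Implicit Types (f g : X -> X) (delta eps : R) (x y z : X).

(** The past [q] is indexed by the opposite of time, hence the reversed roles
    of [q j] and [q j.+1]. *)
Lemma glue_pseudo_orbit f delta (p q : nat -> X) :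
  pos_pseudo_orbits f delta p ->
  (forall j, mdist (f (q j.+1)) (q j) < delta) ->
  p 0%N = q 0%N ->
  pseudo_orbits f delta (glue p q).
Proof.
move=> fp fq pq0 [n|[|n]].
- by rewrite (addrC n%:Z) -intS; exact: fp.
- by rewrite (_ : Negz 0 + 1 = 0) //= pq0; exact: fq.
- rewrite (_ : Negz n.+1 + 1 = Negz n); first exact: fq.
  by rewrite !NegzE -[n.+2]addn1 PoszD opprD addrNK.
Qed.

(** * Straying pseudo-orbits *)

Lemma far_from_one_of_two delta x y z :
  delta <= mdist x y -> delta / 2 <= mdist x z \/ delta / 2 <= mdist y z.
Proof.
move=> far; have := le_trans far (metric_triangle x z y).
rewrite (metric_sym z y).
by have [|] := leP (delta / 2) (mdist x z); [left|right; lra].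
Qed.

(** Keeping the relation [P] between consecutive terms abstract serves both the
    pseudo-orbits of [f] itself and, read backwards in time, those of a map
    whose inverse is [f]. *)
Lemma stray_orbit_or_splice f delta (P : X -> X -> Prop) x z w (m i : nat) :
  (forall t, P t (f t)) -> P (iter m f z) w ->
  delta <= mdist (iter (m.+1 + i) f z) (iter i f w) ->
  exists v : nat -> X, [/\ forall j, P (v j) (v j.+1), v 0%N = z &
    exists k, delta / 2 <= mdist (v k) (iter k f x)].
Proof.
move=> Pf Pjump far.
have [near|near] := far_from_one_of_two (iter (m.+1 + i) f x) far.
  by exists (fun j => iter j f z); split=> //; exists (m.+1 + i)%N.
exists (splice f m.+1 z w); split; [exact: splice_step|exact: splice0|].
by exists (m.+1 + i)%N; rewrite splice_after.
Qed.

Lemma stray_pos_pseudo_orbit f : eventually_sensitive f ->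
  exists2 eps, 0 < eps & forall delta x z, 0 < delta ->
    exists v : nat -> X, [/\ pos_pseudo_orbits f delta v, v 0%N = z &
      exists k, eps <= mdist (v k) (iter k f x)].
Proof.
case=> delta0 delta0_gt0 sens; exists (delta0 / 2); first by rewrite divr_gt0.
move=> delta x z delta_gt0.
(* Starting from [f z] makes the jump time positive. *)
have [n [k [y [yball far]]]] := sens (f z) _ delta_gt0.
apply: (@stray_orbit_or_splice f delta0
  (fun s t => mdist (f s) t < delta) x z y n k).
- by move=> t; rewrite mdistxx.
- by move: yball; rewrite -iterSr ballEmdist.
- by rewrite addSn iterSr.
Qed.

(** The sequence [v] is the past of a pseudo-orbit of [f]: its error at the jump
    is read after an application of [f], which [g y] turns into the distance
    between [y] and the orbit of [z]. *)
Lemma stray_neg_pseudo_orbit f g : cancel g f -> eventually_sensitive g ->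
  exists2 eps, 0 < eps & forall delta x z, 0 < delta ->
    exists v : nat -> X, [/\ forall j, mdist (f (v j.+1)) (v j) < delta,
      v 0%N = z & exists k, eps <= mdist (v k) (iter k g x)].
Proof.
move=> gK [delta0 delta0_gt0 sens].
exists (delta0 / 2); first by rewrite divr_gt0.
move=> delta x z delta_gt0.
(* The bound [delta0] rules out [k = 0], where [g y] would come too late. *)
have eta_gt0 : 0 < Num.min delta delta0 by rewrite lt_min delta_gt0.
have [n [[|k] [y [yball far]]]] := sens z _ eta_gt0.
all: move: yball; rewrite ballEmdist /= lt_min => /andP[y_delta y_delta0].
  by move: far; rewrite addn0 /= leNgt y_delta0.
apply: (@stray_orbit_or_splice g delta0
  (fun s t => mdist (f t) s < delta) x z (g y) n k).
- by move=> t; rewrite gK mdistxx.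
- by rewrite gK metric_sym.
- by rewrite addSnnS -iterSr.
Qed.

(** * Failure of inverse shadowing *)

(** Methods need not be continuous, so the straying pseudo-orbits obtained
    separately at each starting point can be collected into one by choice. *)
Lemma no_pos_T0_inverse_shadowing f x eps : 0 < eps ->
  (forall delta z, 0 < delta ->
    exists v : nat -> X, [/\ pos_pseudo_orbits f delta v, v 0%N = z &
      exists k, eps <= mdist (v k) (iter k f x)]) ->
  ~ pos_T0_inverse_shadowing f.
Proof.
move=> eps_gt0 stray /(_ _ eps_gt0)[delta delta_gt0 shadow].
have [phi phiP] := boolp.choice (fun z => stray delta z delta_gt0).
have [z|y close] := shadow x phi; first by have [] := phiP z.
by have [_ _ [k]] := phiP y; rewrite leNgt close.
Qed.

Lemma no_T0_inverse_shadowing f g x eps : 0 < eps ->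
  (forall delta z, 0 < delta ->
    exists v : int -> X, [/\ pseudo_orbits f delta v, v 0 = z &
      exists k, eps <= mdist (v k) (iterz f g k x)]) ->
  ~ T0_inverse_shadowing f g.
Proof.
move=> eps_gt0 stray /(_ _ eps_gt0)[delta delta_gt0 shadow].
have [phi phiP] := boolp.choice (fun z => stray delta z delta_gt0).
have [z|y close] := shadow x phi; first by have [] := phiP z.
by have [_ _ [k]] := phiP y; rewrite leNgt close.
Qed.

Lemma pos_T0_inverse_shadowing_not_sensitive f x :
  pos_T0_inverse_shadowing f -> ~ eventually_sensitive f.
Proof.
move=> shadow /stray_pos_pseudo_orbit[eps eps_gt0 stray].
apply: (no_pos_T0_inverse_shadowing (x := x) eps_gt0 _ shadow) => delta z.
exact: stray.
Qed.

Lemma T0_inverse_shadowing_not_sensitive f g x : cancel g f ->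
  T0_inverse_shadowing f g -> ~ eventually_sensitive f.
Proof.
move=> gK shadow /stray_pos_pseudo_orbit[eps eps_gt0 stray].
apply: (no_T0_inverse_shadowing (x := x) eps_gt0 _ shadow) => delta z delta_gt0.
have [v [vP v0 [k far]]] := stray delta x z delta_gt0.
exists (glue v (fun j => iter j g z)); split=> //; last by exists (Posz k).
by apply: glue_pseudo_orbit => // j; rewrite iterS gK mdistxx.
Qed.

Lemma T0_inverse_shadowing_inverse_not_sensitive f g x : cancel g f ->
  T0_inverse_shadowing f g -> ~ eventually_sensitive g.
Proof.
move=> gK shadow /(stray_neg_pseudo_orbit gK)[eps eps_gt0 stray].
apply: (no_T0_inverse_shadowing (x := x) eps_gt0 _ shadow) => delta z delta_gt0.
have [v [vP v0 [k far]]] := stray delta x z delta_gt0.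
exists (glue (fun j => iter j f z) v); split=> //.
  by apply: glue_pseudo_orbit => // j; rewrite iterS mdistxx.
(* At time [0] both halves of the glued sequence have the same value. *)
case: k far => [far|k far]; last by exists (Negz k).
by exists 0; move: far; rewrite v0.
Qed.

End NotSensitive.

Theorem theorem3p1 (R : realType) (X : metricType R) (X0 : [set: X] !=set0) :
  (forall f : X -> X, continuous f ->
     pos_T0_inverse_shadowing f -> ~ eventually_sensitive f) /\
  (forall f g : X -> X, homeomorphism f g ->
     T0_inverse_shadowing f g ->
     ~ eventually_sensitive f /\ ~ eventually_sensitive g).
Proof.
case: X0 => x _; split=> [f _|f g [_ _ _ gK] shadow].
  exact: pos_T0_inverse_shadowing_not_sensitive.
split; first exact: (T0_inverse_shadowing_not_sensitive x gK shadow).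
exact: (T0_inverse_shadowing_inverse_not_sensitive x gK shadow).
Qed.
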